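(* Let $X,Y$ be real Banach spaces, let $T\in\mathcal{L}(X,Y)$ be a nonzero linear operator, and let $\mathcal{I},\mathcal{J}$ be ideals on $\omega$ such that $\mathcal{I}$ is tall. Then there is no matrix $A=(A_{n,k}:n,k\in\omega)$ of linear operators in $\mathcal{L}(X,Y)$ which satisfies $$A\in(c(X,\mathcal{I}),c^b(Y,\mathcal{J}))\ \text{ and }\ \mathcal{J}\text{-}\lim A\boldsymbol{x}=T(\mathcal{I}\text{-}\lim\boldsymbol{x})\ \text{ for all }\boldsymbol{x}\in c(X,\mathcal{I}).$$
   Context: $\omega$ is the set of nonnegative integers. An ideal on $\omega$ is a family of subsets of $\omega$ closed under subsets and finite unions; every ideal is assumed to contain all finite sets and to differ from the power set of $\omega$. An ideal $\mathcal{I}$ is tall if every infinite $S\subseteq\omega$ has an infinite subset belonging to $\mathcal{I}$. $\mathcal{I}\text{-}\lim_nx_n=\eta$ means $\{n:x_n\notin U\}\in\mathcal{I}$ for every neighborhood $U$ of $\eta$. For a Banach space $V$, $c(V,\mathcal{I})$ is the space of $\mathcal{I}$-convergent sequences in $V$ and $c^b(V,\mathcal{I})$ its subspace of norm-bounded ones. $\mathcal{L}(X,Y)$ is the space of all (not necessarily bounded) linear operators $X\to Y$. $A\boldsymbol{x}=(A_n\boldsymbol{x})_n$, $A_n\boldsymbol{x}=\sum_kA_{n,k}x_k$, provided each series converges in the norm of $Y$. $A\in(\mathscr{A},\mathscr{B})$ means that $A\boldsymbol{x}$ is well defined and in $\mathscr{B}$ for every $\boldsymbol{x}\in\mathscr{A}$.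 *)

(* Defs.v *)
From HB Require Import structures.
From mathcomp Require Import all_boot all_order all_algebra.
From mathcomp Require Import all_classical all_reals all_analysis.

Set Implicit Arguments.
Unset Strict Implicit.
Unset Printing Implicit Defensive.

Import Order.TTheory GRing.Theory Num.Theory.
Import numFieldNormedType.Exports.

Local Open Scope classical_set_scope.
Local Open Scope ring_scope.

(* Ideals are proper and contain the finite sets; they are thus nonempty. *)
Definition omega_ideal (I : set (set nat)) : Prop :=
  [/\ forall A B : set nat, A `<=` B -> I B -> I A,
      forall A B : set nat, I A -> I B -> I (A `|` B),
      forall A : set nat, finite_set A -> I A
    & I <> [set: set nat]].

Definition tall (I : set (set nat)) : Prop :=
  forall S : set nat, infinite_set S ->
    exists S' : set nat, [/\ S' `<=` S, infinite_set S' & I S'].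

Definition ideal_cvg (V : topologicalType) (I : set (set nat))
    (x : nat -> V) (eta : V) : Prop :=
  forall U : set V, nbhs eta U -> I [set n | ~ U (x n)].

Definition ideal_c (V : topologicalType) (I : set (set nat)) :
    set (nat -> V) :=
  [set x | exists eta : V, ideal_cvg I x eta].

Definition ideal_cb (R : realType) (V : normedModType R)
    (I : set (set nat)) : set (nat -> V) :=
  [set x | ideal_c I x /\ bounded_fun x].

Section MatrixTransform.
Context {R : realType} {X Y : normedModType R}.
Variable A : nat -> nat -> {linear X -> Y}.

Definition transform_defined (x : nat -> X) : Prop :=
  forall n, cvgn (series (fun k => A n k (x k))).

(* Meaningful only under [transform_defined x], as [limn] is total. *)
Definition matrix_transform (x : nat -> X) : nat -> Y :=
  fun n => limn (series (fun k => A n k (x k))).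

Definition matrix_class (D : set (nat -> X)) (E : set (nat -> Y)) : Prop :=
  forall x, D x -> transform_defined x /\ E (matrix_transform x).

End MatrixTransform.

(* Main.v *)
Require Import Defs.
From HB Require Import structures.
From mathcomp Require Import all_boot all_order all_algebra.
From mathcomp Require Import all_classical all_reals all_analysis.
Import Order.TTheory GRing.Theory Num.Theory.
Import numFieldNormedType.Exports.
Local Open Scope classical_set_scope.
Local Open Scope ring_scope.

Set Implicit Arguments.
Unset Strict Implicit.

(** Pick [x0] with [T x0 != 0] and test [A] only on sequences of multiples of
    [x0], so that [A] becomes a matrix [a n k := A n k x0] of vectors of [Y]
    acting on scalar sequences.  The point is that ideal convergence does not
    see, and hence does not bound, the values taken on a set of the ideal:
    every scalar sequence supported on a member of [I] is [I]-null, however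
    fast it grows.

    Each row of [a] has finite support: otherwise tallness gives an infinite
    [S] in [I] inside that support, and normalizing the terms on [S] to norm 1
    makes the series of the row diverge ([normalized_series_dvg]).  Then only
    finitely many columns of [a] are nonzero: otherwise tallness gives an
    infinite [S] in [I] of indices of nonzero columns, and a gliding hump
    along [S] ([gliding_hump]) yields a sequence supported on [S] with an
    unbounded transform.

    Finally, the sequence equal to 0 at the finitely many nonzero columns and
    to [x0] elsewhere [I]-converges to [x0], while its transform is identically
    0, which cannot [J]-converge to [T x0] because [J] is proper. *)

(** * Ideal convergence *)

(** Ideal convergence ignores the values on a set of the ideal, even unbounded
    ones; this is how test sequences are made convergent below. *)
Lemma ideal_cvg_modulo {V : topologicalType} (I : set (set nat)) (S : set nat)
    (x : nat -> V) (eta : V) :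
  omega_ideal I -> I S -> (forall k, ~ S k -> x k = eta) -> ideal_cvg I x eta.
Proof.
move=> [Isub _ _ _] IS xS U /nbhs_singleton Ueta; apply: Isub IS => k /= nUx.
by apply: contrapT => /xS xk; apply: nUx; rewrite xk.
Qed.

(** If [u] differs from [v], the complement of [u] is a neighborhood of [v] that
    the sequence never enters, so all of [nat] would lie in the ideal. *)
Lemma ideal_cvg_cst_eq {R : realType} {V : normedModType R}
    (J : set (set nat)) (u v : V) :
  omega_ideal J -> ideal_cvg J (fun=> u) v -> u = v.
Proof.
move=> [Jsub _ _ Jproper] uv; apply: contrapT => /eqP neq_uv.
apply: Jproper; apply/seteqP; split=> // B _.
have /uv JT : nbhs v (~` [set u]).
  apply: open_nbhs_nbhs; split; last by move=> /= vu; rewrite vu eqxx in neq_uv.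
  apply: closed_openC; apply: accessible_closed_set1.
  exact/hausdorff_accessible/norm_hausdorff.
by apply: Jsub JT => k _ /=; apply.
Qed.

(** * Scalar sequences against a matrix of vectors *)

Lemma infinite_ge (S : set nat) (m : nat) :
  infinite_set S -> exists2 k, S k & (m <= k)%N.
Proof.
move=> infS; apply: contrapT => noS; apply: infS.
apply: (sub_finite_set _ (finite_II m)) => k Sk /=.
by rewrite ltnNge; apply/negP => mk; apply: noS; exists k.
Qed.

Section VectorMatrix.
Context {R : realType} {Y : normedModType R}.

(** The general term of a convergent series tends to 0, whereas here infinitely
    many terms have norm 1. *)
Lemma normalized_series_dvg (b : nat -> Y) (S : set nat) :
  infinite_set S -> (forall k, S k -> b k != 0) ->
  exists2 t : nat -> R, (forall k, ~ S k -> t k = 0)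
    & ~ cvgn (series (fun k => t k *: b k)).
Proof.
move=> infS b0; exists (fun k => if k \in S then `|b k|^-1 else 0).
  by move=> k nSk; rewrite memNset.
move=> /cvg_series_cvg_0 /cvgrPdist_lt /(_ 1 ltr01) [m _ small].
have [k Sk /small] := infinite_ge m infS.
rewrite /= mem_set// sub0r normrN normrZ normfV normr_id.
by rewrite mulVf ?normr_eq0 ?b0// ltxx.
Qed.

Lemma limn_finite_series (u : nat -> Y) (m : nat) :
  (forall k, (m <= k)%N -> u k = 0) -> limn (series u) = \sum_(0 <= k < m) u k.
Proof.
move=> u0; apply: lim_near_cst; first exact: norm_hausdorff.
exists m => // p /= mp; rewrite seriesEnat/= (big_cat_nat (leq0n m) mp)//=.
suff -> : \sum_(m <= k < p) u k = 0 by rewrite addr0.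
by rewrite big_nat big1// => k /andP[mk _]; exact: u0.
Qed.

Lemma large_translate (u v : Y) (M : R) :
  v != 0 -> exists c : R, M <= `|u + c *: v|.
Proof.
move=> v0; exists ((`|M| + `|u|) / `|v|).
set w := _ *: v; have nw : `|w| = `|M| + `|u|.
  by rewrite normrZ normf_div normr_id mulfVK ?normr_eq0// ger0_norm ?addr_ge0.
have := ler_normD (- u) (u + w).
rewrite addKr normrN nw [leRHS]addrC lerD2r.
exact/le_trans/ler_norm.
Qed.

(** One stage of the gliding hump, between pairs of a scalar sequence and a
    threshold.  The scalars below the old threshold are kept; the new threshold
    exceeds the support of the row that has become large, so that later stages,
    which only change scalars beyond it, do not alter the transform there. *)
Definition hump (a : nat -> nat -> Y) (S : set nat) (j : nat)
    (s s' : (nat -> R) * nat) : Prop :=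
  [/\ (s.2 < s'.2)%N,
      forall k, (k < s.2)%N -> s'.1 k = s.1 k,
      forall k, ~ S k -> (s.2 <= k)%N -> s'.1 k = 0
    & exists n, (forall k, (s'.2 <= k)%N -> a n k = 0) /\
        j%:R <= `|\sum_(0 <= k < s'.2) s'.1 k *: a n k| ].

(** Beyond the threshold there is still a place of [S], its column is nonzero in
    some row, and a large enough scalar there outweighs the terms already fixed
    in that row. *)
Lemma hump_exists (a : nat -> nat -> Y) (S : set nat) (j : nat) s :
  (forall n, exists m, forall k, (m <= k)%N -> a n k = 0) ->
  infinite_set S -> (forall k, S k -> exists n, a n k != 0) ->
  exists s', hump a S j s s'.
Proof.
case: s => t m rows infS cols.
have [q Sq mq] := infinite_ge m infS.
have [n anq] := cols q Sq.
have [r ar] := rows n.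
have [c hc] := large_translate (\sum_(0 <= k < m) t k *: a n k) j%:R anq.
pose t' k := if (k < m)%N then t k else if k == q then c else 0.
exists (t', maxn q.+1 r); split=> /=.
- by rewrite leq_max ltnS mq.
- by move=> k km; rewrite /t' km.
- move=> k nSk mk; rewrite /t' ltnNge mk/=.
  by case: eqP => // kq; rewrite kq in nSk.
- exists n; split=> [k|]; first by rewrite geq_max => /andP[_ /ar].
  suff -> : \sum_(0 <= k < maxn q.+1 r) t' k *: a n k =
      \sum_(0 <= k < m) t k *: a n k + c *: a n q by [].
  have qr : (q < maxn q.+1 r)%N by rewrite leq_max leqnn.
  rewrite (big_cat_nat (leq0n m) (leq_trans mq (ltnW qr)))//=; congr (_ + _).
    by apply: eq_big_nat => k /= km; rewrite /t' km.
  rewrite (big_cat_nat mq (ltnW qr))//= big_nat big1 ?add0r; last first.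
    move=> k /andP[mk kq].
    by rewrite /t' ltnNge mk/= (ltn_eqF kq) scale0r.
  rewrite big_ltn// {1}/t' ltnNge mq/= eqxx.
  rewrite big_nat big1 ?addr0// => k /andP[qk _].
  by rewrite /t' ltnNge (leq_trans mq (ltnW qk))/= (gtn_eqF qk) scale0r.
Qed.

(** The places of the new values are chosen one at a time along [S], each beyond
    the supports of the rows already made large; finiteness of the row supports
    makes this possible and freezes the transform at those rows. *)
Lemma gliding_hump (a : nat -> nat -> Y) (S : set nat) :
  (forall n, exists m, forall k, (m <= k)%N -> a n k = 0) ->
  infinite_set S -> (forall k, S k -> exists n, a n k != 0) ->
  exists2 t : nat -> R, (forall k, ~ S k -> t k = 0)
    & forall j : nat, exists n,
        j%:R <= `|limn (series (fun k => t k *: a n k))|.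
Proof.
move=> rows infS cols.
have [step stepP] := choice (fun js : nat * ((nat -> R) * nat) =>
  hump_exists js.1 js.2 rows infS cols).
pose s := fix s j := if j is i.+1 then step (i, s i) else (fun=> 0, 0%N).
have sS j : hump a S j (s j) (s j.+1) by exact: stepP (j, s j).
have s_ge j : (j <= (s j).2)%N.
  elim: j => // j IH; have [lt_s _ _ _] := sS j.
  exact: leq_ltn_trans IH lt_s.
have s_stable j d : ((s j).2 <= (s (j + d)%N).2)%N /\
    forall k, (k < (s j).2)%N -> (s (j + d)%N).1 k = (s j).1 k.
  elim: d => [|d [le_s eq_s]]; first by rewrite addn0.
  rewrite addnS; have [lt_s keep _ _] := sS (j + d)%N.
  split=> [|k kj]; first exact: leq_trans le_s (ltnW lt_s).
  by rewrite keep ?eq_s// (leq_trans kj).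
have s_supp j k : ~ S k -> (s j).1 k = 0.
  move=> nSk; elim: j => // j IH; have [_ keep out _] := sS j.
  by case: (ltnP k (s j).2) => [/keep ->//|]; exact: out.
(* The threshold of stage k.+1 is at least k.+1, so the scalar at k is final
   from that stage on. *)
exists (fun k => (s k.+1).1 k) => [k|j]; first exact: s_supp.
have t_s i k : (k < (s i).2)%N -> (s k.+1).1 k = (s i).1 k.
  move=> ki; case: (leqP i k.+1) => [le_ik|/ltnW le_ki].
    by rewrite -(subnKC le_ik); apply: (s_stable i _).2; rewrite ?subnKC.
  by rewrite -(subnKC le_ki); apply/esym/(s_stable _ _).2/s_ge.
have [_ _ _ [n [row0 large]]] := sS j; exists n.
rewrite (@limn_finite_series _ (s j.+1).2) => [|k /row0 ->]; last first.
  by rewrite scaler0.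
by under eq_big_nat => k /andP[_ /t_s ->] do [].
Qed.

End VectorMatrix.

(** * Operator matrices tested on a line *)

Theorem theorem2p17 (R : realType) (X Y : completeNormedModType R)
    (T : {linear X -> Y}) (hT : (T : X -> Y) <> (fun=> 0))
    (I J : set (set nat)) (hI : omega_ideal I) (hJ : omega_ideal J)
    (hItall : tall I) :
  ~ exists A : nat -> nat -> {linear X -> Y},
      matrix_class A (ideal_c I) (ideal_cb J) /\
      (forall (x : nat -> X) (eta : X), ideal_cvg I x eta ->
         ideal_cvg J (matrix_transform A x) (T eta)).
Proof.
move=> [A [Aclass Alim]].
have [x0 Tx0] : exists x0, T x0 != 0.
  apply: contrapT => T0; apply: hT; apply/funext => x.
  by apply: contrapT => /eqP Tx; apply: T0; exists x.
pose a n k : Y := A n k x0.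
have AE (t : nat -> R) n :
    (fun k => A n k (t k *: x0)) = (fun k => t k *: a n k).
  by apply/funext => k; rewrite linearZ.
have null (S : set nat) (t : nat -> R) : I S -> (forall k, ~ S k -> t k = 0) ->
    ideal_c I (fun k => t k *: x0).
  move=> IS tS; exists 0; apply: (ideal_cvg_modulo _ IS) => // k /tS ->.
  by rewrite scale0r.
have rows n : exists m, forall k, (m <= k)%N -> a n k = 0.
  have fin : finite_set [set k | a n k != 0].
    apply: contrapT => /hItall[S [S_supp infS IS]].
    have [t tS] := normalized_series_dvg infS S_supp; apply.
    by rewrite -AE; exact: (Aclass _ (null S t IS tS)).1.
  have [r r_supp] := (finite_seqP _).1 fin.
  exists (\max_(i <- r) i.+1)%N => k mk; apply: contrapT => /eqP ank.
  have kr : k \in r by have : [set k | a n k != 0] k by []; rewrite r_supp.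
  by move: mk; rewrite leqNgt => /negP; apply; exact: (leq_bigmax_seq k).
have cols : finite_set [set k | exists n, a n k != 0].
  apply: contrapT => /hItall[S [S_cols infS IS]].
  have [t tS large] := gliding_hump rows infS S_cols.
  have [_ [_ [M [_ bnd]]]] := Aclass _ (null S t IS tS).
  have [n] := large (Num.truncn (M + 1)).+1.
  rewrite -AE => /(lt_le_trans (truncnS_gt _)).
  by rewrite ltNge => /negP; apply; apply: bnd => //; rewrite ltrDl.
(* Erasing the finitely many nonzero columns kills the transform but keeps the
   I-limit x0. *)
pose x k : X := if k \in [set k | exists n, a n k != 0] then 0 else x0.
have xx0 : ideal_cvg I x x0.
  have [_ _ Ifin _] := hI.
  by apply: (ideal_cvg_modulo _ (Ifin _ cols)) => // k nk; rewrite /x memNset.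
have Ax0 : matrix_transform A x = fun=> 0.
  apply/funext => n; rewrite /matrix_transform.
  rewrite (@limn_finite_series _ _ _ 0) ?big_geq// => k _.
  rewrite /x; case: ifPn => [_|/negP nk]; first by rewrite linear0.
  apply: contrapT => /eqP ank; apply: nk; apply/mem_set.
  by exists n.
have := Alim _ _ xx0; rewrite Ax0 => /(ideal_cvg_cst_eq hJ) T0.
by rewrite -T0 eqxx in Tx0.
Qed.
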